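(* Let $\mathcal B$ be a finite family of finite sets with $\varnothing\in\mathcal B$. Then $\mathcal B$ is the base of a $\cup$-closed well-graded family if and only if each nonempty $X\in\mathcal B$ has exactly one endpoint.
   Context: All sets and families are finite. For finite sets $P,Q$ let $d(P,Q)=|P\bigtriangleup Q|$. A tight path in a family $\mathcal F$ between distinct $P,Q\in\mathcal F$ is a sequence $P_0=P,P_1,\ldots,P_n=Q$ of members of $\mathcal F$ with $d(P,Q)=n$ and $d(P_i,P_{i+1})=1$ for $0\le i\le n-1$. The family $\mathcal F$ is well-graded if there is a tight path in $\mathcal F$ between any two of its distinct sets. $\mathcal F$ is $\cup$-closed if $\cup\mathcal G\in\mathcal F$ for every nonempty $\mathcal G\subseteq\mathcal F$. The span of a family $\mathcal G$ is the family of all unions of nonempty subfamilies of $\mathcal G$ (so $\varnothing$ is in the span only if $\varnothing\in\mathcal G$). A base of a $\cup$-closed family $\mathcal F$ is a subfamily of $\mathcal F$ whose span is $\mathcal F$ and which is minimal under inclusion with this property. The endpoints of a set $X\in\mathcal B$ are the elements of $X\setminus\bigcup\{Y\in\mathcal B : Y\subsetneq X\}$, i.e. the elements of $X$ contained in no proper subset of $X$ belonging to $\mathcal B$. *)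

(* Defs.v *)
From mathcomp Require Import all_boot.
From mathcomp Require Import finmap.

Set Implicit Arguments.
Unset Strict Implicit.
Unset Printing Implicit Defensive.

Local Open Scope fset_scope.

Definition dist (K : choiceType) (P Q : {fset K}) : nat :=
  #|` (P `\` Q) `|` (Q `\` P)|.

(* The tight path P_0 = P, P_1, ..., P_n = Q is encoded by its head P and the
   sequence s = [:: P_1; ...; P_n]. *)
Definition tight_path (K : choiceType) (F : {fset {fset K}})
    (P Q : {fset K}) (s : seq {fset K}) : bool :=
  [&& all (fun X => X \in F) (P :: s),
      last P s == Q,
      size s == dist P Q &
      path (fun X Y => dist X Y == 1) P s].

Definition well_graded (K : choiceType) (F : {fset {fset K}}) : Prop :=
  forall P Q : {fset K}, P \in F -> Q \in F -> P <> Q ->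
    exists s : seq {fset K}, tight_path F P Q s.

Definition union_closed (K : choiceType) (F : {fset {fset K}}) : Prop :=
  forall G : {fset {fset K}}, G `<=` F -> G <> fset0 -> fcover G \in F.

Definition span (K : choiceType) (G : {fset {fset K}}) : {fset {fset K}} :=
  [fset fcover H | H in fpowerset G & H != fset0].

Definition is_base (K : choiceType) (B F : {fset {fset K}}) : Prop :=
  [/\ B `<=` F,
      span B = F &
      forall C : {fset {fset K}}, C `<=` B -> span C = F -> C = B].

Definition endpoints (K : choiceType) (B : {fset {fset K}})
    (X : {fset K}) : {fset K} :=
  X `\` \bigcup_(Y <- B | Y `<` X) Y.

(* Main.v *)
Require Import Defs.
From mathcomp Require Import all_boot finmap.

Set Implicit Arguments.
Unset Strict Implicit.
Unset Printing Implicit Defensive.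

Local Open Scope fset_scope.

(** Let [U] be the union of the members of [B] properly contained in [X].
    If [B] is a base, then [U <> X]. The first set [P] after [U] on a tight path
    from [U] to [X] satisfies [U `<` P `<=` X] and is a union of members of [B];
    were it different from [X], these members would all lie in [U]. So [P = X],
    and [X `\` U] is a singleton.
    Conversely, suppose endpoints are unique and [Q] is not contained in [P].
    A minimal [Y] in [B] contained in [Q] but not in [P] has all its proper
    subsets from [B] inside [P], so [P `|` Y] exceeds [P] by the endpoint of
    [Y] only: this is one step of a tight path. If [Q] is contained in [P], the
    same construction with the roles exchanged gives the last step. *)

(** * Symmetric-difference distance and tight paths *)

Section Distance.

Context {K : choiceType}.
Implicit Types (P Q X : {fset K}) (F : {fset {fset K}}).

Lemma distC P Q : dist P Q = dist Q P.
Proof. by rewrite /dist fsetUC. Qed.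

Lemma dist_fsub P Q : P `<=` Q -> dist P Q = #|` Q `\` P|.
Proof. by rewrite -fsetD_eq0 /dist => /eqP ->; rewrite fset0U. Qed.

Lemma distxx P : dist P P = 0.
Proof. by rewrite dist_fsub // fsetDv cardfs0. Qed.

Lemma dist0_eq P Q : dist P Q = 0 -> P = Q.
Proof.
by move/cardfs0_eq/eqP; rewrite fsetU_eq0 !fsetD_eq0 -eqEfsubset => /eqP.
Qed.

(** Inclusion-exclusion for the two symmetric differences, whose union contains that of [P] and [Q].
    The intersection term is kept for the equality case. *)
Lemma dist_triangle_cap P X Q :
  dist P Q + #|` ((P `\` X) `|` (X `\` P)) `&` ((X `\` Q) `|` (Q `\` X))|
    <= dist P X + dist X Q.
Proof.
rewrite -[leqRHS]cardfsUI leq_add2r; apply: fsubset_leq_card.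
apply/fsubsetP => z; rewrite !inE.
by case: (z \in P); case: (z \in Q); case: (z \in X).
Qed.

Lemma dist_triangle X P Q : dist P Q <= dist P X + dist X Q.
Proof. exact: leq_trans (leq_addr _ _) (dist_triangle_cap P X Q). Qed.

(** Equality in the triangle inequality makes the two symmetric differences disjoint. As [P] lies in
    [Q], an element of [P] outside [X], or of [X] outside [Q], would belong to both. *)
Lemma dist_between P X Q :
  P `<=` Q -> dist P X + dist X Q <= dist P Q -> P `<=` X /\ X `<=` Q.
Proof.
move=> /fsubsetP sPQ h; move: (leq_trans (dist_triangle_cap P X Q) h).
rewrite -{2}[dist P Q]addn0 leq_add2l leqn0 => /eqP/cardfs0_eq/fsetP cap0.
split; apply/fsubsetP => z zI; have := cap0 z; rewrite !inE.
  by rewrite zI (sPQ _ zI); case: (z \in X).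
by have := sPQ z; rewrite zI; case: (z \in P); case: (z \in Q) => //= /(_ isT).
Qed.

Lemma dist_le_path P s :
  path (fun X Y => dist X Y == 1) P s -> dist P (last P s) <= size s.
Proof.
elim: s P => [|X s IHs] P /=; first by rewrite distxx.
move=> /andP[/eqP dPX /IHs le_s].
by apply: leq_trans (dist_triangle X _ _) _; rewrite dPX add1n ltnS.
Qed.

Lemma tight_path_cons F P X Q s :
  P \in F -> dist P X = 1 -> dist P Q = (dist X Q).+1 ->
  tight_path F X Q s -> tight_path F P Q (X :: s).
Proof.
move=> PF dPX dPQ /and4P[allF lastQ sizeQ pathQ].
by apply/and4P; split=> //=; rewrite ?PF ?dPQ ?dPX ?eqSS.
Qed.

Lemma tight_path_rcons F P X Q s :
  Q \in F -> dist X Q = 1 -> dist P Q = (dist P X).+1 ->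
  tight_path F P X s -> tight_path F P Q (rcons s Q).
Proof.
move=> QF dXQ dPQ /and4P[/= allF /eqP lastX sizeX pathX].
apply/and4P; split=> /=.
- by move: allF; rewrite all_rcons QF.
- by rewrite last_rcons.
- by rewrite size_rcons dPQ eqSS.
- by rewrite rcons_path pathX lastX dXQ.
Qed.

End Distance.

(** * Membership in the span *)

Section Span.

Context {K : choiceType}.
Implicit Types (P Q X Y : {fset K}) (B C H : {fset {fset K}}).

Lemma fcoverP H (x : K) :
  reflect (exists2 Y, Y \in H & x \in Y) (x \in fcover H).
Proof.
apply: (iffP (bigfcupP _ _ _ _)) => [[Y /andP[YH _] xY]|[Y YH xY]].
  by exists Y.
by exists Y; rewrite ?YH.
Qed.

Lemma spanP B P :
  reflect (exists H, [/\ H `<=` B, H != fset0 & P = fcover H]) (P \in span B).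
Proof.
rewrite /span; apply: (iffP (imfsetP _ _ _ _)) => /= [[H]|[H [sHB H0 ->]]].
  by rewrite !inE fpowersetE => /andP[sHB H0] ->; exists H.
by exists H; rewrite // !inE fpowersetE sHB.
Qed.

Lemma mem_fcover_span B H : H `<=` B -> H != fset0 -> fcover H \in span B.
Proof. by move=> sHB H0; apply/spanP; exists H. Qed.

Lemma spanS B C : C `<=` B -> span C `<=` span B.
Proof.
move=> sCB; apply/fsubsetP => _ /spanP[H [sHC H0 ->]].
exact: mem_fcover_span (fsubset_trans sHC sCB) H0.
Qed.

Lemma sub_span B : B `<=` span B.
Proof.
apply/fsubsetP => X XB; apply/spanP; exists [fset X].
rewrite fsub1set XB; split=> //; first by apply/fset0Pn; exists X; rewrite inE.
by rewrite /fcover big_seq_fset1.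
Qed.

(** If members of [B] inside [P] cover [P], then all of them together form a suitable subfamily. The
    first conjunct keeps it nonempty when [P] is empty. *)
Lemma mem_spanP B P :
  reflect ((exists2 Y, Y \in B & Y `<=` P) /\
           forall x, x \in P -> exists Y, [/\ Y \in B, Y `<=` P & x \in Y])
    (P \in span B).
Proof.
apply: (iffP (spanP _ _)) => [[H [/fsubsetP sHB /fset0Pn[Y0 Y0H] ->]]|].
  have sub Y : Y \in H -> Y `<=` fcover H.
    by move=> YH; apply/fsubsetP => x xY; apply/fcoverP; exists Y.
  split; first by exists Y0; auto.
  by move=> x /fcoverP[Y YH xY]; exists Y; split; auto.
case=> [[Y0 Y0B sY0P] cov]; exists [fset Y in B | Y `<=` P]; split.
- by apply/fsubsetP => Y; rewrite !inE => /andP[].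
- by apply/fset0Pn; exists Y0; rewrite !inE Y0B.
- apply/fsetP => x; apply/idP/fcoverP => [/cov[Y [YB sYP xY]]|[Y]].
    by exists Y; rewrite // !inE YB.
  by rewrite !inE => /andP[_ /fsubsetP sYP] /sYP.
Qed.

Lemma spanU B P Q : P \in span B -> Q \in span B -> P `|` Q \in span B.
Proof.
move=> /mem_spanP[[Y YB sYP] covP] /mem_spanP[_ covQ]; apply/mem_spanP.
split; first by exists Y; rewrite // fsubsetU // sYP.
move=> x; rewrite inE => /orP[/covP|/covQ] [Z [ZB sZ xZ]]; exists Z;
  by rewrite fsubsetU ?sZ ?orbT.
Qed.

Lemma span_union_closed B : union_closed (span B).
Proof.
move=> G /fsubsetP sGB /eqP/fset0Pn[P0 P0G]; apply/mem_spanP.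
have sub P : P \in G -> P `<=` fcover G.
  by move=> PG; apply/fsubsetP => x xP; apply/fcoverP; exists P.
split.
  have /mem_spanP[[Y YB sYP] _] := sGB _ P0G.
  by exists Y; rewrite // (fsubset_trans sYP) ?sub.
move=> x /fcoverP[P PG xP]; have /mem_spanP[_ /(_ x xP)] := sGB _ PG.
by case=> Y [YB sYP xY]; exists Y; rewrite (fsubset_trans sYP) ?sub.
Qed.

(** * Endpoints and minimality of a base *)

Lemma endpointsP B X x :
  reflect (x \in X /\ forall Y, Y \in B -> Y `<` X -> x \notin Y)
    (x \in endpoints B X).
Proof.
rewrite inE andbC; apply: (iffP andP) => -[xX xN]; split=> //.
  move=> Y YB sYX; apply: contra xN => xY.
  by apply/bigfcupP; exists Y; rewrite ?YB.
by apply/bigfcupP => -[Y /andP[YB sYX]]; apply/negP/xN.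
Qed.

(** If [C] spans the same family, an endpoint of [X] lies in some member of [C] inside [X]; that
    member cannot be a proper subset, so it is [X]. *)
Lemma base_span B :
  fset0 \in B ->
  (forall X, X \in B -> X <> fset0 -> endpoints B X != fset0) ->
  is_base B (span B).
Proof.
move=> B0 hB; split=> // [|C sCB spanC]; first exact: sub_span.
apply/eqP; rewrite eqEfsubset sCB; apply/fsubsetP => X XB.
have : X \in span C by rewrite spanC (fsubsetP (sub_span B)).
case/mem_spanP => [[Y YC sYX] covX]; case: (X =P fset0) => [X0|/(hB X XB)].
  by move: sYX; rewrite X0 fsubset0 => /eqP <-.
case/fset0Pn => x /endpointsP[/covX[Z [ZC sZX xZ]] xN].
move: sZX; rewrite fsubEproper => /orP[/eqP <- //|pZX].
by have := xN Z (fsubsetP sCB _ ZC) pZX; rewrite xZ.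
Qed.

(** Without endpoints, [X] is covered by its proper subsets in [B], so removing it keeps the span,
    against minimality. *)
Lemma endpoints_base_neq0 B X :
  fset0 \in B -> is_base B (span B) -> X \in B -> X <> fset0 ->
  endpoints B X != fset0.
Proof.
move=> B0 [_ _ minB] XB /eqP Xn0; apply/eqP => E0.
pose C := B `\ X; have sCB : C `<=` B := fsubD1set B X.
suff spanC : span C = span B.
  by move: XB; rewrite -(minB C sCB spanC) !inE eqxx.
(* Since [X] is nonempty, [fset0] survives in [C] and serves as the member required inside every
   [P]. *)
have C0 : fset0 \in C by rewrite !inE eq_sym Xn0.
apply/eqP; rewrite eqEfsubset spanS //; apply/fsubsetP => P.
move=> /mem_spanP[_ covP]; apply/mem_spanP; split.
  by exists fset0; rewrite ?fsub0set.
move=> x /covP[Y [YB sYP xY]].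
have [YX|nYX] := eqVneq Y X; last by exists Y; rewrite !inE nYX.
have : x \notin endpoints B X by rewrite E0.
rewrite inE -YX xY andbT negbK => /bigfcupP[Z /andP[ZB]]; rewrite YX.
move=> pZX xZ; exists Z; rewrite !inE ZB (fproper_neq pZX) xZ.
by rewrite (fsubset_trans (fproper_sub pZX)) -?YX.
Qed.

(** * From unique endpoints to tight paths *)

Lemma tight_step B P Q :
  (forall X, X \in B -> X <> fset0 -> #|` endpoints B X| = 1) ->
  P \in span B -> Q \in span B -> ~~ (Q `<=` P) ->
  exists2 X, X \in span B & dist P X = 1 /\ dist P Q = (dist X Q).+1.
Proof.
move=> hB PB QB /fsubsetPn[q qQ qP].
pose good Y := [&& Y \in B, Y `<=` Q & ~~ (Y `<=` P)].
have [Y gY minY] : exists2 Y, good Y &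
    forall Z, good Z -> #|` Y| <= #|` Z|.
  have /mem_spanP[_ /(_ q qQ)[Y0 [Y0B sY0Q qY0]]] := QB.
  have gY0 : good Y0 by rewrite /good Y0B sY0Q; apply/fsubsetPn; exists q.
  move: {2}#|` Y0| (leqnn #|` Y0|) => n.
  (* Descent on a bound for the cardinality: either [Y] is smallest among the good sets, or a
     smaller one replaces it. *)
  elim: n Y0 gY0 {Y0B sY0Q qY0} => [|n IHn] Y gY leYn.
    by exists Y => // Z _; apply: leq_trans leYn _.
  case: (boolP (has (fun Z => good Z && (#|` Z| < #|` Y|)) B)).
    case/hasP => Z _ /andP[gZ ltZ]; apply: IHn gZ _.
    by rewrite -ltnS (leq_trans ltZ).
  move/hasPn => minY; exists Y => // Z gZ; have /and3P[ZB _ _] := gZ.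
  by have := minY Z ZB; rewrite gZ -leqNgt.
have /and3P[YB /fsubsetP sYQ nYP] := gY.
have Yn0 : Y <> fset0 by move=> Y0; move: nYP; rewrite Y0 fsub0set.
(* A member of [B] properly inside [Y] that meets [Y] outside [P] would be a smaller good set. *)
have sYE : Y `\` P `<=` endpoints B Y.
  apply/fsubsetP => y; rewrite !inE => /andP[yP yY]; rewrite yY andbT.
  apply/bigfcupP => -[Z /andP[ZB pZY] yZ].
  have gZ : good Z.
    rewrite /good ZB (fsubset_trans (fproper_sub pZY)); last exact/fsubsetP.
    by apply/fsubsetPn; exists y.
  by have := minY Z gZ; rewrite leqNgt fproper_ltn_card.
have card1 : #|` Y `\` P| = 1.
  apply/eqP; rewrite eqn_leq -{1}(hB Y YB Yn0) fsubset_leq_card //.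
  by rewrite cardfs_gt0 fsetD_eq0.
exists (P `|` Y).
  by apply: spanU => //; apply: (fsubsetP (sub_span B)).
have sub1 : P `<=` P `|` Y by apply: fsubsetUl.
split; first by rewrite dist_fsub // fsetDUl fsetDv fset0U.
(* As [Y] lies in [Q], the symmetric difference of [P] and [Q] is the disjoint union of [Y] minus
   [P] and the symmetric difference of [P] with [Y] adjoined and [Q]. *)
rewrite /dist -add1n -card1 -cardfsUI.
rewrite [X in (_ + #|` X|)%N](_ : _ = fset0) ?cardfs0 ?addn0; last first.
  apply/fsetP => z; rewrite !inE; have := sYQ z.
  by case: (z \in Y); case: (z \in P); case: (z \in Q) => // /(_ isT).
congr #|` _|; apply/fsetP => z; rewrite !inE; have := sYQ z.
by case: (z \in Y); case: (z \in P); case: (z \in Q) => // /(_ isT).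
Qed.

(** Induction on the distance. Distance 0 is allowed, with the empty sequence as path, so the
    induction does not carry [P <> Q]. *)
Lemma span_well_graded B :
  (forall X, X \in B -> X <> fset0 -> #|` endpoints B X| = 1) ->
  well_graded (span B).
Proof.
move=> hB P Q PB QB _; move dn : (dist P Q) => n.
elim: n P Q PB QB dn => [|n IHn] P Q PB QB dn.
  by rewrite -(dist0_eq dn); exists [::]; rewrite /tight_path /= PB eqxx distxx.
have [sQP|nQP] := boolP (Q `<=` P); last first.
  have [X XB [dPX dPQ]] := tight_step hB PB QB nQP.
  have [|s ts] := IHn X Q XB QB; first by apply: succn_inj; rewrite -dPQ.
  by exists (X :: s); apply: tight_path_cons ts.
have nPQ : ~~ (P `<=` Q).
  apply/negP => sPQ; have PQ : P = Q by apply/eqP; rewrite eqEfsubset sPQ.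
  by move: dn; rewrite PQ distxx.
have [X XB [dQX dQP]] := tight_step hB QB PB nPQ.
move: dQX dQP; rewrite distC => dXQ; rewrite distC (distC X) => dPQ.
have [|s ts] := IHn P X PB XB; first by apply: succn_inj; rewrite -dPQ.
by exists (rcons s Q); apply: tight_path_rcons ts.
Qed.

End Span.

(** * Unique endpoints as a criterion for well-gradedness *)

Theorem lemma19 (K : choiceType) (B : {fset {fset K}})
    (hB : fset0 \in B) :
  (exists F : {fset {fset K}},
     [/\ union_closed F, well_graded F & is_base B F]) <->
  (forall X : {fset K}, X \in B -> X <> fset0 -> #|` endpoints B X| = 1).
Proof.
split=> [[F [_ wgF baseF]] X XB Xn0|hE]; last first.
  exists (span B); split; [exact: span_union_closed|exact: span_well_graded|].
  by apply: base_span => // X XB /(hE X XB) E1; rewrite -cardfs_gt0 E1.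
have spanF : span B = F by case: baseF.
subst F; have En0 := endpoints_base_neq0 hB baseF XB Xn0.
pose U := \bigcup_(Y <- B | Y `<` X) Y.
have sUX : U `<=` X.
  by apply/bigfcupsP => Y _ /fproper_sub.
have subU Y : Y \in B -> Y `<` X -> Y `<=` U.
  move=> YB pYX; apply/fsubsetP => y yY; apply/bigfcupP.
  by exists Y; rewrite ?YB.
(* [X] may have no nonempty proper subset in [B]; then [U] is empty and is in the span through
   [fset0]. *)
have UB : U \in span B.
  apply/mem_spanP; split; first by exists fset0; rewrite ?fsub0set.
  by move=> x /bigfcupP[Y /andP[YB pYX] xY]; exists Y; rewrite subU.
have UX : U <> X.
  by move=> UX; move: En0; rewrite /endpoints -/U UX fsetDv eqxx.
have XsB : X \in span B := fsubsetP (sub_span B) X XB.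
have [[|P s] /and4P[/= allF /eqP lastX /eqP sizeX]] := wgF U X UB XsB UX.
  by move: UX; rewrite -lastX.
case/andP=> /eqP dUP /dist_le_path; rewrite lastX => le_s.
(* The path after [P] has one step fewer than [dist U X], which bounds [dist P X], so [P] attains
   equality in the triangle inequality. *)
have [sUP sPX] : U `<=` P /\ P `<=` X.
  by apply: dist_between => //; rewrite dUP -sizeX add1n ltnS.
have [PX|/eqP nPX] := P =P X.
  by rewrite /endpoints -/U -dist_fsub // -PX.
have /and3P[_ /mem_spanP[_ covP] _] := allF.
have /eqP PU : P == U.
  rewrite eqEfsubset sUP andbT; apply/fsubsetP => x /covP[Y [YB sYP xY]].
  apply: (fsubsetP (subU Y YB _)) xY; apply: fsub_proper_trans sYP _.
  by rewrite fproperEneq nPX.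
by move: dUP; rewrite PU distxx.
Qed.
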